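(* Let $N\ge3$, $r,r'\in\mathbb{Z}$, $1\le k,k'\le N/2$ and $\eta,\eta'\in\{-1,1\}$. A necessary and sufficient condition for the existence of a permutation $\mathfrak{S}$ of $\mathbb{Z}/N\mathbb{Z}$ such that, for any $G_{r'}(N,k',\eta')$-invariant loop $x'(t)$ whose $j'$th body motion is $(h'_{j'}(t),z'_{j'}(t))$, the loop $x(t)$ whose $j$th body motion is $(h_j(t),z_j(t)):=\left(h'_{\mathfrak{S}(j)}(t),z'_{\mathfrak{S}(j)}(t)\right)$ is $G_r(N,k,\eta)$-invariant, is that the following conditions be satisfied: 1) $r-r'=2p\in2\mathbb{Z}$; 2') $-k\eta+k'\eta'-2pk\eta k'\eta'=0\pmod N$. The permutation $\mathfrak{S}$ and its inverse are then respectively $j\mapsto j'=(1-2pk\eta)j$ and $j'\mapsto j=(1+2pk'\eta')j'$ in $\mathbb{Z}/N\mathbb{Z}$.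
   Context: Bodies are labelled by $\mathbb{Z}/N\mathbb{Z}$, positions in $\mathbb{R}^3=\mathbb{C}\times\mathbb{R}$. A $1$-periodic loop $x(t)=(h_j(t),z_j(t))_{j\in\mathbb{Z}/N\mathbb{Z}}$ is $G_r(N,k,\eta)$-invariant if for every $(\theta,\delta,\beta,\xi)\in\mathbb{R}/\mathbb{Z}\times\mathbb{Z}/N\mathbb{Z}\times\mathbb{Z}/2\mathbb{Z}\times\{\pm1\}$ with $\theta\equiv\frac\beta2+k\eta\frac\delta N\pmod1$, and all $j,t$, $$h_j(t)=e^{2\pi i\alpha}\,\overline{h_{\xi(j+\delta)}(\xi(t-\theta))}^{\,\xi},\qquad z_j(t)=(-1)^\beta z_{\xi(j+\delta)}(\xi(t-\theta)),\qquad\alpha=r\theta-\frac\delta N\pmod1,$$ where $\overline{h}^{\,\xi}=h$ if $\xi=1$ and $\bar h$ (complex conjugate) if $\xi=-1$.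
   Formalization: For even N the permutation is not unique (adding N/2 to it also works), so it is proved that the displayed map with the displayed inverse works, and that any such permutation and its inverse equal the displayed ones plus a common constant c with 2c=0 in Z/NZ (c=0 if N is odd). *)

(* Defs.v *)
(* MathComp / MathComp-Analysis. *)
From HB Require Import structures.
From mathcomp Require Import all_boot all_order all_algebra all_fingroup.
From mathcomp Require Import all_classical all_reals all_analysis.
From mathcomp Require Import complex.
Set Implicit Arguments.
Unset Strict Implicit.
Unset Printing Implicit Defensive.
Import Order.TTheory GRing.Theory Num.Theory numFieldNormedType.Exports.
Local Open Scope ring_scope.
Local Open Scope complex_scope.

(* The position space R^3 = C x R; a loop x has components
   h_j(t) = (x j t).1 and z_j(t) = (x j t).2.  The library puts no topology on
   R[i], so continuity is required of the three real coordinates. *)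
Definition is_loop (R : realType) (N : nat) (x : 'Z_N -> R -> R[i] * R) : Prop :=
  forall j : 'Z_N,
    [/\ periodic (x j) 1,
        continuous (fun t : R => Re (x j t).1),
        continuous (fun t : R => Im (x j t).1) &
        continuous (fun t : R => (x j t).2)].

Definition expi2pi (R : realType) (a : R) : R[i] :=
  cos (2 * pi * a) +i* sin (2 * pi * a).

Definition eqmod1 (R : realType) (a b : R) : Prop :=
  exists m : int, a - b = m%:~R.

Definition conj_sign (R : realType) (xi : int) (w : R[i]) : R[i] :=
  if xi == 1 then w else conjc w.

(* Elements of R/Z are represented by real numbers, and those of Z/N and Z/2 are
   sent to R through their representatives in [0, N) and [0, 2).  Changing the
   representative of delta or beta preserves the congruence on theta; changing
   that of theta or alpha is harmless since r is an integer and x is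
   1-periodic. *)
Definition G_invariant (R : realType) (r : int) (N k : nat) (eta : int)
    (x : 'Z_N -> R -> R[i] * R) : Prop :=
  forall (theta : R) (delta : 'Z_N) (beta : 'Z_2) (xi : int),
    xi = 1 \/ xi = -1 ->
    eqmod1 theta
      ((beta : nat)%:R / 2 + k%:R * eta%:~R * ((delta : nat)%:R / N%:R)) ->
    forall alpha : R,
    eqmod1 alpha (r%:~R * theta - (delta : nat)%:R / N%:R) ->
    forall (j : 'Z_N) (t : R),
      (x j t).1 = expi2pi alpha *
        conj_sign xi (x (xi%:~R * (j + delta)) (xi%:~R * (t - theta))).1 /\
      (x j t).2 = (-1) ^+ (beta : nat) *
        (x (xi%:~R * (j + delta)) (xi%:~R * (t - theta))).2.

Definition G_invariant_loop (R : realType) (r : int) (N k : nat) (eta : int)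
    (x : 'Z_N -> R -> R[i] * R) : Prop :=
  is_loop x /\ G_invariant r k eta x.

Definition carries_invariant_loops (R : realType) (N : nat)
    (r : int) (k : nat) (eta : int) (r' : int) (k' : nat) (eta' : int)
    (S : {perm 'Z_N}) : Prop :=
  forall x' : 'Z_N -> R -> R[i] * R,
    G_invariant_loop r' k' eta' x' ->
    G_invariant_loop r k eta (fun j t => x' (S j) t).

(* Main.v *)
Require Import Defs.
From HB Require Import structures.
From mathcomp Require Import all_boot all_order all_algebra all_fingroup.
From mathcomp Require Import all_classical all_reals all_analysis.
From mathcomp Require Import complex.
From mathcomp Require Import ring lra.
Import Order.TTheory GRing.Theory Num.Theory numFieldNormedType.Exports.
Local Open Scope ring_scope.

(** Put [K = k * eta] and [K' = k' * eta'].  The symmetry group gives two kinds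
    of relations: the choreographic shift by [delta], which relates bodies [j]
    and [j + delta] with the time delay [K * delta / N] and the horizontal
    phase [r * theta - delta / N], and the half-period and reversal symmetries.

    Sufficiency.  Let [m = 1 - 2 * p * K], so that the congruence
    relating [k] and [k'] says [K' * m = K] modulo [N].  The relation indexed by
    [(theta, delta, beta, xi)] in the first group, once bodies are relabelled
    by [j |-> m * j], is literally the relation indexed by
    [(theta, m * delta, beta, xi)] in the second group.  The constraint on
    [theta] is preserved because [K' * m = K], and the phase [alpha] is preserved
    because [(r - r') * theta = 2 * p * theta] equals [2 * p * K * delta / N]
    modulo 1, the term [p * beta] being an integer.  This is
    [reindex_invariant].  The identity [(1 + 2 * p * K') * m = 1] modulo [N]
    makes the relabelling a permutation.

    Necessity.  A single invariant loop suffices as a test,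
      [h_j t = exp (2 pi i (j / N + r' t))],
      [z_j t = cos (2 pi (t + K' j / N))],
    because all its labels and delays can be read off from its phases.  If [S]
    transports it to a loop invariant under the first group, then the
    half-period symmetry of [h] forces [r - r'] to be even; the shift by [j]
    forces [S j = m * j + S 0]; the time reversal fixing body [0] forces
    [2 * S 0 = 0]; and the shift by [1] of the vertical component forces
    [K' * m = K].  This is [carries_invariant_loops_affine].

    All these equalities live in [R / Z].  They are written as membership of a
    difference in [Num.int], and the map [phase : d |-> d / N], an embedding of
    [Z / N] in [R / Z], turns them into equalities in ['Z_N]. *)

(** * The exponential on R / Z *)

Lemma eqmod1P (R : realType) (a b : R) : eqmod1 a b <-> a - b \is a Num.int.
Proof. by split=> [[m e]|/intrP[m e]]; [apply/intrP|]; exists m. Qed.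

(** Congruences modulo 1 are proved below by exhibiting their difference as an
    explicit combination of known integers, with a [ring] or [field] identity;
    this is the transfer step. *)
Lemma int_num_eq (R : realType) (a b : R) :
  a \is a Num.int -> a = b -> b \is a Num.int.
Proof. by move=> a_int <-. Qed.

Lemma expi2piD (R : realType) (a b : R) :
  expi2pi (a + b) = expi2pi a * expi2pi b.
Proof.
rewrite /expi2pi mulrDr cosD sinD; apply/eqP; rewrite eq_complex /= eqxx /=.
by rewrite addrC.
Qed.

Lemma expi2piN (R : realType) (a : R) : expi2pi (- a) = conjc (expi2pi a).
Proof. by rewrite /expi2pi mulrN cosN sinN. Qed.

Lemma conj_sign_expi2pi (R : realType) (xi : int) (a : R) :
  xi = 1 \/ xi = -1 -> conj_sign xi (expi2pi a) = expi2pi (xi%:~R * a).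
Proof.
by case=> ->; rewrite /conj_sign /= ?mul1r// mulrNz mulr1z mulN1r expi2piN.
Qed.

(** After translating [a] into [[0, 1)], the duplication formula
    [cos (2 x) = 1 - 2 (sin x)^2] at [x = pi * a] leaves only [a = 0], since
    [sin] is positive on [(0, pi)]. *)
Lemma cos2pi_eq1 (R : realType) (a : R) :
  cos (2 * pi * a) = 1 <-> a \is a Num.int.
Proof.
have cosDn b (n : nat) : cos (2 * pi * (b + n%:R)) = cos (2 * pi * b) :> R.
  elim: n => [|n IH]; first by rewrite addr0.
  by rewrite -(natr1 n) addrA [_ * (_ + 1)]mulrDr mulr1 -IH mulr_natl cosD2pi.
have cosDz b (m : int) : cos (2 * pi * (b + m%:~R)) = cos (2 * pi * b) :> R.
  case: m => n; first exact: cosDn.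
  by rewrite -(cosDn (b + _) n.+1) NegzE mulrNz subrK.
split=> [|/intrP[m ->]]; last by rewrite -[m%:~R]add0r cosDz mulr0 cos0.
have /andP[] := floor_itv a; set m := Num.floor a => m_le.
rewrite intrD1 => a_lt; rewrite -(subrK m%:~R a) cosDz; set b := a - m%:~R.
have b0 : 0 <= b by rewrite subr_ge0.
have b1 : b < 1 by rewrite ltrBlDl.
have [b_eq0|b_neq0] := eqVneq b 0; first by rewrite b_eq0 add0r intr_int.
have pi0 := pi_gt0 R.
have : 0 < sin (pi * b).
  by apply: sin_gt0_pi; rewrite gtr_pMr// b1 mulr_gt0// lt0r b_neq0.
have -> : 2 * pi * b = pi * b + pi * b by ring.
have := cos2Dsin2 (pi * b); rewrite cosD; set c := cos _; set s := sin _ => *.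
nra.
Qed.

Lemma expi2pi_eq1 (R : realType) (a : R) :
  expi2pi a = 1 <-> a \is a Num.int.
Proof.
rewrite -cos2pi_eq1; split=> [[]//|c1]; rewrite /expi2pi c1.
by rewrite (cos1sin0 _) ?c1 ?normr1.
Qed.

Lemma expi2pi_eq (R : realType) (a b : R) :
  expi2pi a = expi2pi b <-> a - b \is a Num.int.
Proof.
have inv : expi2pi b * expi2pi (- b) = 1 :> R[i].
  by rewrite -expi2piD subrr; apply/expi2pi_eq1; rewrite rpred0.
rewrite -expi2pi_eq1 expi2piD; split=> [->//|e].
by rewrite -[LHS]mulr1 -inv mulrCA mulrC e mul1r.
Qed.

Lemma cos2pi_congr (R : realType) (a b : R) :
  a - b \is a Num.int -> cos (2 * pi * a) = cos (2 * pi * b).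
Proof. by move/expi2pi_eq=> []. Qed.

(** * The embedding of Z / N in R / Z *)

Lemma intr_Zp_eq0 (N : nat) (m : int) : (1 < N)%N ->
  (m%:~R == 0 :> 'Z_N) = (N%:Z %| m)%Z.
Proof.
move=> N1; have nat_case n : (n%:R == 0 :> 'Z_N) = (N%:Z %| n%:Z)%Z.
  by rewrite -val_eqE /= val_Zp_nat.
by case: m => n; rewrite ?NegzE ?mulrNz ?oppr_eq0 ?dvdzN//; exact: nat_case.
Qed.

Lemma int_divN (R : realType) (N : nat) (m : int) : (1 < N)%N ->
  (m%:~R / N%:R : R) \is a Num.int = (m%:~R == 0 :> 'Z_N).
Proof.
move=> N1; have N0 : N%:R != 0 :> R by rewrite pnatr_eq0 -lt0n ltnW.
rewrite intr_Zp_eq0//; apply/intrP/dvdzP => -[q e]; exists q.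
  by apply/eqP; rewrite -(eqr_int R) intrM -e divfK.
by rewrite e intrM mulfK.
Qed.

(** Only the class of [phase d] modulo 1 depends canonically on [d]; the
    representative in [[0, 1)] is the one the symmetry group is written with. *)
Definition phase (R : realType) (N : nat) (d : 'Z_N) : R :=
  (d : nat)%:R / N%:R.
Arguments phase R [N] d.

Lemma phase_intr (R : realType) (N : nat) (d : 'Z_N) (m : int) : (1 < N)%N ->
  (phase R d - m%:~R / N%:R \is a Num.int) = (d == m%:~R).
Proof.
move=> N1; rewrite /phase -mulrBl -[_%:R in LHS]/((d : nat)%:Z%:~R) -intrB.
by rewrite int_divN// intrB -[_%:~R]/((d : nat)%:R) natr_Zp subr_eq0.
Qed.

Lemma phase_eq (R : realType) (N : nat) (d e : 'Z_N) : (1 < N)%N ->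
  (phase R d - phase R e \is a Num.int) = (d == e).
Proof.
move=> N1; rewrite {2}/phase -[(e : nat)%:R]/((e : nat)%:Z%:~R).
by rewrite phase_intr// -[_%:~R]/((e : nat)%:R) natr_Zp.
Qed.

Lemma phaseD (R : realType) (N : nat) (d e : 'Z_N) : (1 < N)%N ->
  phase R (d + e) - (phase R d + phase R e) \is a Num.int.
Proof.
move=> N1; rewrite /phase -mulrDl -natrD.
rewrite -[_%:R in X in _ - X]/(((d + e)%N : int)%:~R).
by rewrite phase_intr// -[_%:~R]/((d + e)%N%:R) natrD !natr_Zp.
Qed.

Lemma phaseMz (R : realType) (N : nat) (m : int) (d : 'Z_N) : (1 < N)%N ->
  phase R (m%:~R * d) - m%:~R * phase R d \is a Num.int.
Proof.
move=> N1; rewrite /phase mulrA -[(d : nat)%:R]/((d : nat)%:Z%:~R) -intrM.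
by rewrite phase_intr// intrM -[_%:Z%:~R]/((d : nat)%:R) natr_Zp.
Qed.

(** * Relabelling bodies by a multiplication *)

(** The relation for [(theta, delta, beta, xi)] at the relabelled loop is the
    relation for [(theta, m * delta, beta, xi)] at the original one, with the
    same phase [alpha]. *)
Lemma reindex_invariant (R : realType) (N : nat) (r r' : int) (k k' : nat)
    (eta eta' p : int) (x : 'Z_N -> R -> R[i] * R) : (1 < N)%N ->
  r - r' = 2 * p ->
  (k'%:Z * eta' * (1 - 2 * p * k%:Z * eta))%:~R = (k%:Z * eta)%:~R :> 'Z_N ->
  G_invariant_loop r' k' eta' x ->
  G_invariant_loop r k eta (fun j => x ((1 - 2 * p * k%:Z * eta)%:~R * j)).
Proof.
move=> N1 rp Ka [loop_x inv_x].
split=> [j|theta delta beta xi xi_sign]; first exact: loop_x.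
set m := 1 - 2 * p * k%:Z * eta in Ka *.
move=> /eqmod1P theta_int alpha /eqmod1P alpha_int j t.
have rE : r%:~R = r'%:~R + 2 * p%:~R :> R.
  by rewrite -[r](subrK r') rp intrD intrM addrC.
have mE : m%:~R = 1 - 2 * p%:~R * k%:R * eta%:~R :> R.
  by rewrite intrB !intrM.
have phi_int : k%:R * eta%:~R * phase R delta
    - k'%:R * eta'%:~R * phase R (m%:~R * delta) \is a Num.int.
  apply: int_num_eq (rpredB (phaseMz R N (k'%:Z * eta') (m%:~R * delta) N1)
                            (phaseMz R N (k%:Z * eta) delta N1)) _.
  have -> : (k'%:Z * eta')%:~R * (m%:~R * delta) = (k%:Z * eta)%:~R * delta.
    by rewrite mulrA -intrM Ka.
  by rewrite !intrM; ring.
rewrite mulrCA mulrDr.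
apply: (inv_x theta (m%:~R * delta) beta xi xi_sign); apply/eqmod1P.
- apply: int_num_eq (rpredD theta_int phi_int) _.
  by rewrite -!/(@phase R N _); ring.
(* The phases differ by [2 p (theta - K delta / N)], which is the sum of the
   integers [2 p (theta - beta / 2 - K delta / N)] and [p beta]. *)
- have p_int : p%:~R \is a @Num.int R by exact: intr_int.
  have beta_int : (beta : nat)%:R \is a @Num.int R by exact: rpred_nat.
  apply: int_num_eq (rpredD (rpredD alpha_int (phaseMz R N m delta N1))
    (rpredM p_int (rpredD beta_int (rpredMn 2 theta_int)))) _.
  by rewrite -!/(@phase R N _) rE mE; field.
Qed.

(** * The uniformly rotating test loop *)

(** The real and imaginary parts of a complex number are here themselves
    complex numbers, so continuity of the horizontal coordinates is with values
    in [R[i]] with the topology of its norm.  That norm restricts to the absolute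
    value on [R]. *)
Lemma continuous_real_complex (R : realType) (f : R -> R) :
  continuous f -> continuous (fun t => (f t)%:C%C : (R[i] : numClosedFieldType)).
Proof.
move=> cf t; apply/cvgrPdist_lt => eps eps0.
have [epsE eps_gt0] : eps = (complex.Re eps)%:C%C /\ 0 < complex.Re eps.
  by case: eps eps0 => a b; rewrite ltcE /= => /andP[/eqP -> ?].
have /cvgrPdist_lt/(_ _ eps_gt0) := cf t.
apply: filterS => u ftu.
rewrite epsE -rmorphB normc_def /= [_ ^+ 2 + _]addrC expr0n add0r sqrtr_sqr.
by rewrite ltcR.
Qed.

(** The half-period symmetry allows the horizontal frequencies congruent to [r]
    modulo 2 and, because of the sign [(-1)^beta], the odd vertical frequencies.
    Choosing [r] leaves the horizontal phase of body [j] equal to [phase j], and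
    choosing [1] makes the delay [k * eta * j / N] visible modulo 1. *)
Definition circular_loop (R : realType) (N : nat) (r : int) (k : nat)
    (eta : int) (j : 'Z_N) (t : R) : R[i] * R :=
  (expi2pi (phase R j + r%:~R * t),
   cos (2 * pi * (t + k%:R * eta%:~R * phase R j))).

Lemma circular_loopP (R : realType) (N : nat) (r : int) (k : nat) (eta : int) :
  (1 < N)%N -> G_invariant_loop r k eta (@circular_loop R N r k eta).
Proof.
move=> N1.
split=> [j|theta delta beta xi xi_sign /eqmod1P theta_int
         alpha /eqmod1P alpha_int j t].
  have affine (a b c : R) : continuous (fun t : R => a * (b + c * t)).
    move=> t; apply: cvgM; first exact: cvg_cst.
    apply: cvgD; first exact: cvg_cst.
    by apply: cvgM; [exact: cvg_cst|exact: cvg_id].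
  split.
  - move=> t; rewrite /circular_loop; congr pair.
      apply/expi2pi_eq; rewrite mulrDr mulr1 addrA [_ + r%:~R]addrC addrK.
      exact: intr_int.
    apply: cos2pi_congr; rewrite [X in X - _]addrAC [X in X - _]addrC addrK.
    exact: rpred1.
  - under eq_fun do rewrite -complexRe.
    apply: continuous_real_complex => t.
    exact: (continuous_comp (affine (2 * pi) (phase R j) r%:~R t)
                            (@continuous_cos R _)).
  - under eq_fun do rewrite -complexIm.
    apply: continuous_real_complex => t.
    exact: (continuous_comp (affine (2 * pi) (phase R j) r%:~R t)
                            (@continuous_sin R _)).
  - rewrite /=; under eq_fun do rewrite addrC -[X in _ + X]mul1r.
    move=> t.
    exact: (continuous_comp
      (affine (2 * pi) (k%:R * eta%:~R * phase R j) 1 t) (@continuous_cos R _)).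
set d := xi%:~R * (j + delta).
have xi2 : xi%:~R * xi%:~R = 1 :> R.
  by case: xi_sign => ->; rewrite ?mulrNz ?mulrNN mulr1.
have xiK y : xi%:~R * (xi%:~R * y) = y :> R by rewrite mulrA xi2 mul1r.
have d_int : xi%:~R * phase R d - (phase R j + phase R delta) \is a Num.int.
  apply: int_num_eq (rpredD
    (rpredM (intr_int R xi) (phaseMz R N xi (j + delta) N1))
    (phaseD R N j delta N1)) _.
  by rewrite mulrBr xiK -/d; ring.
have K_int : k%:R * eta%:~R \is a @Num.int R.
  by rewrite rpredM ?rpred_nat ?intr_int.
split; rewrite /circular_loop /=.
  rewrite conj_sign_expi2pi// -expi2piD; apply/expi2pi_eq.
  rewrite -rpredN.
  apply: int_num_eq (rpredD d_int alpha_int) _.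
  rewrite -!/(@phase R N _).
  have -> : xi%:~R * (phase R d + r%:~R * (xi%:~R * (t - theta)))
          = xi%:~R * phase R d + r%:~R * (t - theta).
    by rewrite [LHS]mulrDr [X in _ + X = _]mulrCA xiK.
  by ring.
have cos_xi y : cos (2 * pi * y) = cos (2 * pi * (xi%:~R * y)) :> R.
  by case: xi_sign => ->; rewrite ?mul1r// mulrNz mulN1r mulrN cosN.
have cos_beta y : (-1) ^+ (beta : nat) * cos (2 * pi * y)
    = cos (2 * pi * (y + (beta : nat)%:R / 2)) :> R.
  case: (beta) => -[|[|//]] /= _; first by rewrite mul0r addr0 mul1r.
  rewrite expr1 mulN1r -cosDpi; congr cos.
  by field.
rewrite [in RHS]cos_xi cos_beta; apply: cos2pi_congr.
rewrite -rpredN.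
apply: int_num_eq (rpredB (rpredM K_int d_int) theta_int) _.
rewrite -!/(@phase R N _) [xi%:~R * (_ * _ + _)]mulrDr xiK.
by ring.
Qed.

(** * Necessity *)

(** Invariance of the relabelled test loop is evaluated at the half-period shift,
    the choreographic shifts (horizontally and vertically) and the time reversal.
    Each relation becomes a congruence modulo 1 between phases. *)
Lemma carries_invariant_loops_affine (R : realType) (N : nat) (r r' : int)
    (k k' : nat) (eta eta' : int) (S : {perm 'Z_N}) : (1 < N)%N ->
  carries_invariant_loops R r k eta r' k' eta' S ->
  exists p : int,
    [/\ r - r' = 2 * p,
        forall j, S j = (1 - 2 * p * k%:Z * eta)%:~R * j + S 0,
        S 0 + S 0 = 0 &
        (k'%:Z * eta' * (1 - 2 * p * k%:Z * eta))%:~R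
          = (k%:Z * eta)%:~R :> 'Z_N].
Proof.
move=> N1 /(_ _ (circular_loopP R N r' k' eta' N1))[_ inv].
have [p rp] : exists p : int, r - r' = 2 * p.
  have [] := inv (1 / 2) 0 1 1 (or_introl erefl) _ (r%:~R * (1 / 2)) _ 0 0.
  - by apply/eqmod1P; rewrite !(mul0r, mulr0) addr0 subrr rpred0.
  - by apply/eqmod1P; rewrite !(mul0r, mulr0) subr0 subrr rpred0.
  rewrite conj_sign_expi2pi; last by left.
  rewrite -expi2piD mul1r addr0 => /expi2pi_eq + _.
  rewrite !mulr0 => /intrP[q qE].
  exists (- q); apply: (mulrIz (oner_neq0 R)).
  rewrite -[LHS]/((r - r')%:~R) -[RHS]/((2 * - q)%:~R) intrM intrB intrN -qE.
  by field.
exists p; set m := 1 - 2 * p * k%:Z * eta.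
have rE : r%:~R = r'%:~R + 2 * p%:~R :> R.
  by rewrite -[r](subrK r') rp intrD intrM addrC.
have mE : m%:~R = 1 - 2 * p%:~R * k%:R * eta%:~R :> R.
  by rewrite intrB !intrM.
have theta_ok (j : 'Z_N) : eqmod1 (k%:R * eta%:~R * phase R j)
    ((nat_of_ord (0 : 'Z_2))%:R / 2 + k%:R * eta%:~R * ((j : nat)%:R / N%:R)).
  by apply/eqmod1P; rewrite [X in _ - (X + _)]mul0r add0r subrr rpred0.
have alpha_ok (j : 'Z_N) : eqmod1
    (r%:~R * (k%:R * eta%:~R * phase R j) - phase R j)
    (r%:~R * (k%:R * eta%:~R * phase R j) - (j : nat)%:R / N%:R).
  by apply/eqmod1P; rewrite subrr rpred0.
have shift j t := inv _ j 0 1 (or_introl erefl) (theta_ok j) _ (alpha_ok j) 0 t.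
have S_int j :
    m%:~R * phase R j + phase R (S 0) - phase R (S j) \is a Num.int.
  have [+ _] := shift j 0.
  rewrite conj_sign_expi2pi; last by left.
  rewrite -expi2piD => /expi2pi_eq; rewrite !mul1r mulr0 addr0 !add0r => S_int.
  by apply: int_num_eq S_int _; rewrite rE mE; ring.
split=> //.
- move=> j; apply/eqP; rewrite -(phase_eq R)// -rpredN.
  apply: int_num_eq (rpredD (rpredD (S_int j) (phaseMz R N m j N1))
    (phaseD R N (m%:~R * j) (S 0) N1)) _.
  by ring.
- have [||+ _] := inv 0 0 0 (-1) (or_intror erefl) _ 0 _ 0 0.
  + by apply/eqmod1P; rewrite !(mul0r, mulr0) addr0 subrr rpred0.
  + by apply/eqmod1P; rewrite !(mul0r, mulr0) !subr0 rpred0.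
  rewrite conj_sign_expi2pi; last by right.
  rewrite -expi2piD => /expi2pi_eq.
  rewrite addr0 subr0 !mulr0 !addr0 add0r => S0_int.
  apply/eqP; rewrite -(phase_eq R)// [phase R 0]mul0r subr0.
  apply: int_num_eq (rpredD S0_int (phaseD R N (S 0) (S 0) N1)) _.
  by ring.
(* At this time the left-hand side is [cos 0 = 1], so that the cosine on the
   right determines its argument modulo 1. *)
- have [_] := shift 1 (- (k'%:R * eta'%:~R * phase R (S 0))).
  rewrite /= addNr mulr0 cos0 !mul1r add0r => /esym/cos2pi_eq1 z_int.
  apply/eqP; rewrite -(phase_eq R)//.
  have K'_int : k'%:R * eta'%:~R \is a @Num.int R.
    by rewrite rpredM ?rpred_nat ?intr_int.
  apply: int_num_eq (rpredD (rpredD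
    (rpredB (phaseMz R N (k'%:Z * eta' * m) 1 N1)
            (phaseMz R N (k%:Z * eta) 1 N1))
    (rpredM K'_int (S_int 1))) z_int) _.
  by rewrite !mulr1 !intrM; ring.
Qed.

(** * Sufficiency and the form of the permutation *)

Lemma mod_condition (N k k' : nat) (eta eta' p : int) : (1 < N)%N ->
  (- (k%:Z * eta) + k'%:Z * eta' - 2 * p * k%:Z * eta * k'%:Z * eta'
     = 0 %[mod N%:Z])%Z <->
  (k'%:Z * eta' * (1 - 2 * p * k%:Z * eta))%:~R = (k%:Z * eta)%:~R :> 'Z_N.
Proof.
move=> N1; set e := (X in (X = 0 %[mod _])%Z).
have eE : k'%:Z * eta' * (1 - 2 * p * k%:Z * eta) = e + k%:Z * eta.
  by rewrite /e; ring.
rewrite eE intrD; split=> [/eqP|/eqP].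
  by rewrite eqz_mod_dvd subr0 -intr_Zp_eq0// => /eqP ->; rewrite add0r.
rewrite -subr_eq0 addrK intr_Zp_eq0// => N_dvd.
by apply/eqP; rewrite eqz_mod_dvd subr0.
Qed.

(** With [K = k * eta] and [K' = k' * eta'], the reason is the identity
    [(1 + 2 p K') (1 - 2 p K) = 1 + 2 p (K' (1 - 2 p K) - K)]. *)
Lemma reindex_inverse (N k k' : nat) (eta eta' p : int) :
  (k'%:Z * eta' * (1 - 2 * p * k%:Z * eta))%:~R = (k%:Z * eta)%:~R :> 'Z_N ->
  (1 + 2 * p * k'%:Z * eta')%:~R * (1 - 2 * p * k%:Z * eta)%:~R = 1 :> 'Z_N.
Proof.
move=> Ka; rewrite -intrM.
have -> : (1 + 2 * p * k'%:Z * eta') * (1 - 2 * p * k%:Z * eta)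
  = 1 + 2 * p * (k'%:Z * eta' * (1 - 2 * p * k%:Z * eta) - k%:Z * eta).
  by ring.
by rewrite intrD intrM intrB Ka subrr mulr0 addr0.
Qed.

Lemma carries_invariant_loops_linear (R : realType) (N : nat) (r r' : int)
    (k k' : nat) (eta eta' p : int) : (1 < N)%N ->
  r - r' = 2 * p ->
  (k'%:Z * eta' * (1 - 2 * p * k%:Z * eta))%:~R = (k%:Z * eta)%:~R :> 'Z_N ->
  exists S : {perm 'Z_N},
    [/\ carries_invariant_loops R r k eta r' k' eta' S,
        forall j : 'Z_N, S j = (1 - 2 * p * k%:Z * eta)%:~R * j &
        forall j' : 'Z_N, (S^-1)%g j' = (1 + 2 * p * k'%:Z * eta')%:~R * j'].
Proof.
move=> N1 rp Ka; have nm1 := reindex_inverse _ _ _ _ _ _ Ka.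
have mK : cancel ( *%R ((1 - 2 * p * k%:Z * eta)%:~R : 'Z_N))
                 ( *%R (1 + 2 * p * k'%:Z * eta')%:~R).
  by move=> j; rewrite mulrA nm1 mul1r.
exists (perm (can_inj mK)); split=> [x inv_x|j|j']; last 2 first.
- by rewrite permE.
- by apply: (@perm_inj _ (perm (can_inj mK))); rewrite permKV permE mulrA
    [X in X * _]mulrC nm1 mul1r.
have -> : (fun j t => x (perm (can_inj mK) j) t)
        = (fun j => x ((1 - 2 * p * k%:Z * eta)%:~R * j)).
  by apply/funext => j; rewrite permE.
exact: reindex_invariant rp Ka inv_x.
Qed.

Theorem proposition18 (R : realType) (N : nat) (hN : (3 <= N)%N)
    (r r' : int) (k k' : nat)
    (hk : (1 <= k)%N /\ (2 * k <= N)%N) (hk' : (1 <= k')%N /\ (2 * k' <= N)%N)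
    (eta eta' : int)
    (heta : eta = 1 \/ eta = -1) (heta' : eta' = 1 \/ eta' = -1) :
  ((exists S : {perm 'Z_N}, carries_invariant_loops R r k eta r' k' eta' S) <->
   (exists p : int, r - r' = 2 * p /\
      (- (k%:Z * eta) + k'%:Z * eta' - 2 * p * k%:Z * eta * k'%:Z * eta'
         = 0 %[mod N%:Z])%Z))
  /\
  (forall p : int, r - r' = 2 * p ->
     (- (k%:Z * eta) + k'%:Z * eta' - 2 * p * k%:Z * eta * k'%:Z * eta'
        = 0 %[mod N%:Z])%Z ->
     (exists S : {perm 'Z_N},
        carries_invariant_loops R r k eta r' k' eta' S /\
        (forall j : 'Z_N, S j = (1 - 2 * p * k%:Z * eta)%:~R * j) /\
        (forall j' : 'Z_N,
           (S^-1)%g j' = (1 + 2 * p * k'%:Z * eta')%:~R * j'))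
     /\
     (forall S : {perm 'Z_N},
        carries_invariant_loops R r k eta r' k' eta' S ->
        exists c : 'Z_N, c + c = 0 /\
        (forall j : 'Z_N, S j = (1 - 2 * p * k%:Z * eta)%:~R * j + c) /\
        (forall j' : 'Z_N,
           (S^-1)%g j' = (1 + 2 * p * k'%:Z * eta')%:~R * j' + c))).
Proof.
have N1 : (1 < N)%N by exact: ltnW.
split; first split=> [[S /(carries_invariant_loops_affine _ _ _ _ _ _ _ _ _ N1)]
                     |[p [rp /(mod_condition _ _ _ _ _ _ N1) Ka]]].
- case=> p [rp _ _ Ka]; exists p; split=> //.
  exact/(mod_condition _ _ _ _ _ _ N1).
- have [S [carS _ _]] :=
    carries_invariant_loops_linear R N r r' _ _ _ _ _ N1 rp Ka.
  by exists S.
move=> p rp /(mod_condition _ _ _ _ _ _ N1) Ka; split.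
  have [S [carS SE SVE]] :=
    carries_invariant_loops_linear R N r r' _ _ _ _ _ N1 rp Ka.
  by exists S.
move=> S /(carries_invariant_loops_affine _ _ _ _ _ _ _ _ _ N1)[p' [rp' SE S0 _]].
have pE : p' = p by apply: (@mulfI _ (2 : int)) => //; rewrite -rp' -rp.
rewrite {p' rp'}pE in SE.
exists (S 0); split=> //; split=> // j'.
apply: (@perm_inj _ S); rewrite permKV SE mulrDr mulrA [X in X * _]mulrC.
rewrite (reindex_inverse _ _ _ _ _ _ Ka) mul1r -addrA.
(* [m * c + c = (1 - p K) (c + c)] vanishes because [c + c = 0]. *)
have -> : (1 - 2 * p * k%:Z * eta)%:~R * S 0 + S 0
        = (1 - p * k%:Z * eta)%:~R * (S 0 + S 0).
  by rewrite !intrB !intrM; ring.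
by rewrite S0 mulr0 addr0.
Qed.
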